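(* Let $p>3$ be a prime and let $a\in\mathbb{Z}$ with $p\nmid a$. Then $$\sum_{k=1}^{(p-1)/2}\frac{1}{\cot\left(\pi\frac{ak^2}{p}\right)-1}=\sum_{k=1}^{(p-1)/2}\frac{1}{1-\tan\left(\pi\frac{ak^2}{p}\right)}-\frac{p-1}{2}=\frac p4\left(\left(\frac{-1}{p}\right)-1\right)+\left(\frac{-2a}{p}\right)\frac{\sqrt p}{2}\sum_{k=1}^{(p-1)/2}(-1)^k\left(\frac kp\right).$$
   Context: Here $\left(\frac{\cdot}{p}\right)$ denotes the Legendre symbol. *)

(* Defs.v *)
From mathcomp Require Import all_boot all_order all_algebra.
From mathcomp Require Import all_classical all_reals all_analysis.

Set Implicit Arguments.
Unset Strict Implicit.
Unset Printing Implicit Defensive.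

Import Order.TTheory GRing.Theory Num.Theory.
Local Open Scope ring_scope.

(* Legendre symbol (a / p); only meaningful for p an odd prime. *)
Definition legendre (a : int) (p : nat) : int :=
  if (p %| a)%Z then 0
  else if [exists x : 'I_p, (x%:Z ^+ 2 == a %[mod p])%Z] then 1
  else -1.

Definition cot (R : realType) (x : R) : R := cos x / sin x.

(* Main.v *)
(* With [x = pi a k^2 / p] and [w = exp (2 i x)], a [p]-th root of unity,
   [1 / (1 - tan x) - 1 = 1 / (i - 1) + 1 / (w - i)], and
   [(1 - i^p) / (w - i)] is the polynomial [sum_(j < p) i^(p-1-j) w^j].  Summing over
   [k] turns each power of [w] into a quadratic Gauss sum, and what remains is the
   value of [sum_j (j/p) i^(p-1-j)], split over even [j = 2k] and odd [j = p - 2k].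
   The sign of the Gauss sum comes from Gauss's evaluation of the alternating sum of
   q-binomials as [prod (1 - q^(2k-1))]. *)
Require Import Defs.
From mathcomp Require Import all_boot all_order all_algebra all_field.
From mathcomp Require Import all_classical all_reals all_analysis.
From mathcomp Require Import complex ring lra zify.
Import Order.TTheory GRing.Theory Num.Theory.
Local Open Scope ring_scope.

(** * Gaussian binomial coefficients *)

(** Pascal's rule replaces the usual quotient of products, so that [q] may be a root of unity. *)
Fixpoint qbinom {K : comNzRingType} (q : K) (m j : nat) : K :=
  match m, j with
  | _, 0 => 1
  | 0, _.+1 => 0
  | m'.+1, j'.+1 => qbinom q m' j' + q ^+ j * qbinom q m' j
  end.

Lemma qbinom0r (K : comNzRingType) (q : K) m : qbinom q m 0 = 1.
Proof. by case: m. Qed.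

Lemma qbinom_small (K : comNzRingType) (q : K) m j :
  (m < j)%N -> qbinom q m j = 0.
Proof.
elim: m j => [|m IH] [|j] //= h; rewrite !IH ?mulr0 ?addr0 //.
exact: leqW.
Qed.

Lemma qbinomSS (K : comNzRingType) (q : K) m j :
  qbinom q m.+1 j.+1 = qbinom q m j + q ^+ j.+1 * qbinom q m j.+1.
Proof. by []. Qed.

(** Division-free ratio of neighbours in a row. In row [m.+1], Pascal's rule and induction bring
    both sides to [(1 - q ^+ m.+1) * qbinom q m j]. *)
Lemma qbinom_absorb (K : comNzRingType) (q : K) m j : (j <= m)%N ->
  (1 - q ^+ j.+1) * qbinom q m j.+1 = (1 - q ^+ (m - j)) * qbinom q m j.
Proof.
elim: m j => [|m IH] j hj.
  by move: hj; rewrite leqn0 => /eqP -> /=; rewrite mulr0 expr0 subrr mul0r.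
case: (ltnP m j) => [mj|jm].
  have -> : j = m.+1 by apply/eqP; rewrite eqn_leq hj mj.
  by rewrite qbinom_small // subnn expr0 subrr mulr0 mul0r.
rewrite qbinomSS mulrDr mulrCA (IH _ jm).
have qj : q ^+ m.+1 = q ^+ j.+1 * q ^+ (m - j) by rewrite -exprD addSn subnKC.
transitivity ((1 - q ^+ m.+1) * qbinom q m j); first by rewrite qj; ring.
case: j {hj qj} jm => [|j] jm; first by rewrite !qbinom0r subn0.
have qj : q ^+ m.+1 = q ^+ j.+1 * q ^+ (m - j) by rewrite -exprD addSn subnKC // ltnW.
rewrite subSS qbinomSS [in RHS]mulrDr -IH 1?ltnW // qj; ring.
Qed.

Lemma qbinom_mulS (K : comNzRingType) (q : K) m j : (j <= m)%N ->
  (1 - q ^+ j.+1) * qbinom q m.+1 j.+1 = (1 - q ^+ m.+1) * qbinom q m j.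
Proof.
move=> h /=; rewrite mulrDr mulrCA qbinom_absorb //.
rewrite (_ : q ^+ m.+1 = q ^+ j.+1 * q ^+ (m - j)); first by ring.
by rewrite -exprD addSn subnKC.
Qed.

Lemma sum_qbinom (K : comNzRingType) (q : K) n :
  \sum_(j < n.*2.+1) (-1) ^+ j * qbinom q n.*2 j
  = \prod_(1 <= k < n.+1) (1 - q ^+ k.*2.-1).
Proof.
elim: n => [|n IH]; first by rewrite big_ord1 big_nil /= mulr1.
rewrite big_nat_recr //= -IH; set m := n.*2.
(* Pascal's rule weights row [M] by [1 - q ^+ j]; [qbinom_mulS] then lowers the row once more, with
   a factor free of [j]. Two rows thus cost one odd factor [1 - q ^+ m.+1]. *)
have rec M : \sum_(j < M.+2) (-1) ^+ j * qbinom q M.+1 j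
           = - \sum_(j < M.+1) (-1) ^+ j * ((1 - q ^+ j) * qbinom q M j).
  rewrite big_ord_recl expr0 mul1r qbinom0r.
  under eq_bigr => i _ do rewrite lift0 exprS mulN1r qbinomSS mulrDr.
  rewrite big_split /=.
  have -> : \sum_(i < M.+1) - (-1) ^+ i * (q ^+ i.+1 * qbinom q M i.+1)
      = \sum_(j < M.+1) (-1) ^+ j * (q ^+ j * qbinom q M j) - 1.
    rewrite [in LHS]big_ord_recr /= qbinom_small // !mulr0 addr0.
    rewrite big_ord_recl !expr0 !mul1r qbinom0r addrC addKr.
    by apply: eq_bigr => i _; rewrite lift0 [(-1) ^+ i.+1]exprS mulN1r.
  rewrite addrCA subrKC -sumrN -big_split.
  by apply: eq_bigr => i _ /=; ring.
rewrite doubleS rec big_ord_recl expr0 subrr mul0r mulr0 add0r -sumrN mulr_suml.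
apply: eq_bigr => i _; rewrite lift0.
have im : (i <= m)%N by rewrite -ltnS.
have /= -> := qbinom_mulS _ q _ _ im.
by rewrite exprS; ring.
Qed.

(** * Sums over the prime field and its quadratic character *)

Lemma sum_Fp (p : nat) (p_prime : prime p) (V : nmodType) (f : 'F_p -> V) :
  \sum_x f x = \sum_(0 <= j < p) f j%:R.
Proof.
transitivity (\sum_(0 <= j < (Zp_trunc (pdiv p)).+2) f j%:R).
  by rewrite big_mkord; apply: eq_bigr => i _; rewrite natr_Zp.
by apply: (f_equal (fun m => \sum_(0 <= j < m) f j%:R)); exact: Fp_cast.
Qed.

Lemma sum_Fp_half (p n : nat) (p_prime : prime p) (pn : p = n.*2.+1)
    (V : nmodType) (f : 'F_p -> V) :
  \sum_x f x = f 0 + \sum_(1 <= k < n.+1) (f k%:R + f (- k%:R)).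
Proof.
rewrite sum_Fp // big_ltn ?prime_gt0 //; congr (_ + _).
rewrite (big_cat_nat (n := n.+1)) ?big_split //=; last by lia.
congr (_ + _); rewrite big_nat_rev /= -{1}(addn1 n) addnC.
rewrite big_addn (_ : (p - n = n.+1)%N); last by lia.
apply: eq_big_nat => k /andP[k1 kn]; congr f.
rewrite (_ : (1 + n + p - (k + n).+1 = p - k)%N); last by lia.
by rewrite natrB ?pchar_Fp_0 ?sub0r //; lia.
Qed.

Definition quad_char (F : finFieldType) (x : F) : int :=
  if x == 0 then 0 else if [exists y, y ^+ 2 == x] then 1 else -1.

(** Moves the symbol into the field ['F_p], where Euler's criterion makes it multiplicative. *)
Lemma legendreE (p : nat) (p_prime : prime p) (a : int) :
  legendre a p = quad_char 'F_p a%:~R.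
Proof.
have chp := pchar_Fp p_prime.
rewrite /legendre /quad_char (dvdz_pcharf chp); case: eqP => // _.
congr (if _ then _ else _); apply/existsP/existsP => -[x].
  rewrite eqz_mod_dvd (dvdz_pcharf chp) rmorphB rmorphXn /= subr_eq0 => h.
  by exists x%:R.
move=> h; have xp : (x < p)%N by rewrite -[X in (_ < X)%N](Fp_cast p_prime).
exists (Ordinal xp).
rewrite eqz_mod_dvd (dvdz_pcharf chp) rmorphB rmorphXn /= subr_eq0.
by rewrite (_ : (x : nat)%:Z%:~R = x) //; exact: natr_Zp.
Qed.

(** Each [y] has exactly [1 + quad_char F y] square roots. *)
Lemma sum_sqr (F : finFieldType) (two0 : (2 : F) != 0) (V : pzRingType) (f : F -> V) :
  \sum_x f (x ^+ 2) = \sum_y (1 + (quad_char F y)%:~R) * f y.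
Proof.
rewrite (partition_big (fun x => x ^+ 2) xpredT) //; apply: eq_bigr => y _.
rewrite (eq_bigr (fun=> f y)); last by move=> x /eqP ->.
rewrite (eq_bigl [in [pred x | x ^+ 2 == y]]) // sumr_const -[LHS]mulr_natl; congr (_ * _); rewrite /quad_char.
case: eqVneq => [->|y0].
  rewrite (eq_card (B := pred1 (0 : F))) ?card1 ?addr0 // => x.
  by rewrite !inE /= [LHS]expf_eq0.
case: existsP => [[c /eqP cy]|h].
  rewrite (eq_card (B := pred2 c (- c))) ?card2; last first.
    by move=> x; rewrite !inE /= -cy eqf_sqr.
  have /negPf -> : c != - c.
    rewrite -subr_eq0 opprK -mulr2n -mulr_natl mulf_neq0 //.
    by apply: contraNneq y0 => c0; rewrite -cy c0 expr0n.
  by [].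
rewrite (eq_card0 (A := _)) ?subrr // => x; apply/negbTE/negP => /= hx.
by apply: h; exists x.
Qed.

(** Euler's criterion. A nonsquare with [x ^+ n = 1] would join the [n] nonzero squares as one root
    too many of ['X^n - 1]. *)
Lemma quad_charE (F : finFieldType) (n : nat) (Fn : #|F| = n.*2.+1) (x : F) :
   (0 < n)%N -> (2 : F) != 0 -> (quad_char F x)%:~R = x ^+ n.
Proof.
move=> n0 two0; rewrite {1}/quad_char; case: eqVneq => [->|x0].
  by rewrite expr0n; case: n n0 {Fn}.
have x1 y : y != 0 -> (y ^+ n.*2) = 1 :> F.
  by move=> y0; apply: (mulfI y0); rewrite -exprS -Fn expf_card mulr1.
case: existsP => [[c /eqP cx]|h].
  rewrite -cx -exprM mul2n x1 //.
  by apply: contraNneq x0 => c0; rewrite -cx c0 expr0n.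
have := x1 x x0; rewrite -muln2 exprM => /eqP; rewrite sqrf_eq1 => /orP[|/eqP -> //].
move=> xn; pose S := [seq y <- enum F | quad_char F y == 1].
(* Counting the field by square roots ([sum_sqr] with constant 1) gives
   [n.*2.+1 = 1 + 2 * size S]. *)
have sS : size S = n.
  have := sum_sqr F two0 int (fun=> 1).
  rewrite sumr_const (eq_card (B := F)) // Fn.
  have -> : \sum_y (1 + (quad_char F y)%:~R) * 1
      = (\sum_(y : F) ((y == 0%R) + 2 * (quad_char F y == 1%R))%N)%:R :> int.
    rewrite natr_sum; apply: eq_bigr => y _; rewrite mulr1 /quad_char.
    by case: (eqVneq y 0) => _ //; case: existsP.
  rewrite big_split -big_distrr /= -!big_mkcond /= big_pred1_eq sum1_card.
  rewrite size_filter -sum1_count big_enum_cond sum1_card /=.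
  move=> /eqP; rewrite eqr_nat; lia.
have : all (root ('X^n - 1 : {poly F})) (x :: S).
  apply/allP => y; rewrite inE => /predU1P[->|].
    by rewrite rootE !hornerE (eqP xn) subrr.
  rewrite mem_filter /quad_char => /andP[]; case: (eqVneq y 0) => // y0.
  case: existsP => // -[c /eqP cy] _ _.
  rewrite rootE !hornerE -cy -exprM mul2n x1 ?subrr //.
  by apply: contraNneq y0 => c0; rewrite -cy c0 expr0n.
move/max_poly_roots => /(_ (monic_neq0 (monicXnsubC _ n0))) /=.
rewrite sS size_XnsubC // ltnn; case/(_ _)/negP => //.
rewrite filter_uniq ?enum_uniq // andbT mem_filter /quad_char (negPf x0).
by case: existsP => // /h.
Qed.

Lemma quad_char_values (F : finFieldType) (x : F) : quad_char F x \in [:: -1; 0; 1].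
Proof. by rewrite /quad_char; do 2?case: ifP. Qed.

(** Euler's criterion holds in [F]; this carries identities between character values back to the
    integers. *)
Lemma intr_inj_signs (F : fieldType) (two0 : (2 : F) != 0) :
  {in [:: -1; 0; 1] &, injective (fun u : int => u%:~R : F)}.
Proof.
move=> u v; rewrite !inE => /or3P[] /eqP -> /or3P[] /eqP -> //=;
  rewrite ?rmorphN ?rmorph0 ?rmorph1 /= => /eqP.
- by rewrite oppr_eq0 oner_eq0.
- by rewrite eq_sym -subr_eq0 opprK (negPf two0).
- by rewrite eq_sym oppr_eq0 oner_eq0.
- by rewrite eq_sym oner_eq0.
- by rewrite -subr_eq0 opprK (negPf two0).
- by rewrite oner_eq0.
Qed.

Lemma quad_charM (F : finFieldType) (n : nat) (Fn : #|F| = n.*2.+1) (x y : F) :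
  (0 < n)%N -> (2 : F) != 0 ->
  quad_char F (x * y) = quad_char F x * quad_char F y.
Proof.
move=> n0 two0; apply: (intr_inj_signs F two0) => /=.
- exact: quad_char_values.
- have := quad_char_values F x; have := quad_char_values F y; rewrite !inE.
  by move=> /or3P[] /eqP -> /or3P[] /eqP ->.
- by rewrite rmorphM /= !(quad_charE F n) // exprMn.
Qed.

Lemma quad_charN1 (F : finFieldType) (n : nat) (Fn : #|F| = n.*2.+1) :
  (0 < n)%N -> (2 : F) != 0 -> quad_char F (-1) = (-1) ^+ n.
Proof.
move=> n0 two0; apply: (intr_inj_signs F two0) => /=.
- exact: quad_char_values.
- by rewrite -signr_odd; case: (odd n).
- by rewrite (quad_charE F n) // rmorphXn rmorphN rmorph1.
Qed.

Lemma quad_char_sqr (F : finFieldType) (x : F) : x != 0 -> quad_char F x ^+ 2 = 1.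
Proof. by rewrite /quad_char => /negPf ->; case: ifP. Qed.

(** * Additive characters and quadratic Gauss sums *)

Lemma char_natmul (V : nmodType) (K : comNzRingType) (psi : V -> K)
    (psi0 : psi 0 = 1) (psiD : {morph psi : x y / x + y >-> x * y}) x k :
  psi (x *+ k) = psi x ^+ k.
Proof. by elim: k => [|k IH]; rewrite ?mulr0n ?psi0 // mulrS psiD IH exprS. Qed.

(** For [x != 0], 1 is a natural multiple of [x], so [psi x = 1] would force [psi 1 = 1]. *)
Lemma char_eq1 (p : nat) (K : comNzRingType) (psi : 'F_p -> K)
    (psi0 : psi 0 = 1) (psiD : {morph psi : x y / x + y >-> x * y})
    (psi1 : psi 1 != 1) x : psi x = 1 -> x = 0.
Proof.
move=> px; apply/eqP; apply: contraNT psi1 => x0; apply/eqP.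
rewrite -(mulfV x0) -(natr_Zp x^-1) mulr_natr char_natmul //.
by rewrite px expr1n.
Qed.

(** Translating [x] by [b^-1] multiplies the sum by [psi 1], which is not 1. *)
Lemma sum_char (p : nat) (K : idomainType) (psi : 'F_p -> K)
    (psiD : {morph psi : x y / x + y >-> x * y})
    (psi1 : psi 1 != 1) b : b != 0 -> \sum_x psi (b * x) = 0.
Proof.
move=> b0; apply/eqP; set S := \sum_x _.
have : S = psi 1 * S.
  rewrite /S mulr_sumr (reindex_inj (addrI b^-1)) /=; apply: eq_bigr => x _.
  by rewrite mulrDr mulfV // psiD.
move/eqP; rewrite -subr_eq0 -{1}[S]mul1r -mulrBl mulf_eq0 subr_eq0 eq_sym.
by rewrite (negPf psi1).
Qed.

Definition gauss_sum (F : finFieldType) (K : pzRingType) (psi : F -> K) (b : F) : K :=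
  \sum_x psi (b * x ^+ 2).

(** Counting square roots gives the sum weighted by [quad_char], as the constant part vanishes by
    orthogonality; rescaling [y] by [b] then extracts the sign. *)
Lemma gauss_sumE (p n : nat) (p_prime : prime p) (pn : p = n.*2.+1) (n0 : (0 < n)%N)
    (two0 : (2 : 'F_p) != 0) (K : idomainType)
    (psi : 'F_p -> K) (psiD : {morph psi : x y / x + y >-> x * y})
    (psi1 : psi 1 != 1) b : b != 0 ->
  gauss_sum 'F_p K psi b = (quad_char 'F_p b)%:~R * gauss_sum 'F_p K psi 1.
Proof.
have Fn : #|'F_p| = n.*2.+1 by rewrite card_Fp.
have E c : c != 0 ->
    gauss_sum 'F_p K psi c = \sum_y (quad_char 'F_p y)%:~R * psi (c * y).
  move=> c0; rewrite /gauss_sum (sum_sqr _ two0 K (fun z => psi (c * z))).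
  under eq_bigr do rewrite mulrDl mul1r.
  by rewrite big_split /= sum_char // add0r.
move=> b0; rewrite !E ?oner_eq0 // mulr_sumr [RHS](reindex_inj (mulfI b0)) /=.
apply: eq_bigr => y _; rewrite mul1r (quad_charM _ _ Fn) // rmorphM /= !mulrA.
by rewrite -rmorphM -expr2 quad_char_sqr // rmorph1 mul1r.
Qed.

(** The algebraic form of [|G|^2 = p], with [psi (- x)] in place of the conjugate. Writing
    [x = y + t] gives [x^2 - y^2 = t^2 + 2ty], and the sum over [y] kills every [t != 0]. *)
Lemma gauss_sum_conj (p : nat) (p_prime : prime p) (two0 : (2 : 'F_p) != 0)
    (K : idomainType) (psi : 'F_p -> K) (psi0 : psi 0 = 1)
    (psiD : {morph psi : x y / x + y >-> x * y}) (psi1 : psi 1 != 1) :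
  gauss_sum 'F_p K psi 1 * gauss_sum 'F_p K psi (-1) = p%:R.
Proof.
rewrite mulrC /gauss_sum mulr_suml.
transitivity (\sum_(y : 'F_p) \sum_(t : 'F_p) psi (t ^+ 2) * psi (2 * t * y)).
  apply: eq_bigr => y _; rewrite mulr_sumr (reindex_inj (addrI y)) /=.
  by apply: eq_bigr => t _; rewrite -!psiD; congr psi; ring.
rewrite exchange_big (bigD1 0) //= [X in _ + X]big1 ?addr0; last first.
  by move=> t t0; rewrite -mulr_sumr sum_char ?mulr0 // mulf_neq0.
under eq_bigr do rewrite expr0n mulr0 mul0r psi0 mulr1.
by rewrite sumr_const card_Fp.
Qed.

(** As [q ^+ p = 1], the ratio of neighbours in row [p - 1] is [- q^-(j+1)]. The choice
    [q = psi (-2)] makes the exponents add up to [2 + 4 + ... + 2j = j^2 + j]. *)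
Lemma qbinom_char (p n : nat) (p_prime : prime p) (pn : p = n.*2.+1)
    (two0 : (2 : 'F_p) != 0)
    (K : idomainType) (psi : 'F_p -> K) (psi0 : psi 0 = 1)
    (psiD : {morph psi : x y / x + y >-> x * y}) (psi1 : psi 1 != 1) j :
  (j <= n.*2)%N ->
  qbinom (psi (- 2)) n.*2 j = (-1) ^+ j * psi (j%:R ^+ 2 + j%:R).
Proof.
elim: j => [|j IH] jn; first by rewrite qbinom0r expr0n addr0 psi0 mulr1.
have /IH {}IH := ltnW jn.
have := qbinom_absorb _ (psi (-2)) _ _ (ltnW jn).
rewrite -!(char_natmul _ _ psi psi0 psiD) IH.
(* In ['F_p], [n.*2 = -1], so [n.*2 - j] becomes [-(j + 1)]. *)
have -> : - (2 : 'F_p) *+ (n.*2 - j) = 2 * j.+1%:R.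
  have := pchar_Fp_0 p_prime; rewrite -(mulr_natr (-2)) natrB; last exact: ltnW.
  rewrite [X in X%:R = 0]pn -(natr1 n.*2) -(natr1 j) => /eqP.
  by rewrite addr_eq0 => /eqP ->; ring.
have -> : - (2 : 'F_p) *+ j.+1 = - (2 * j.+1%:R) by rewrite -(mulr_natr (-2)) mulNr.
set u := 2 * _; have u0 : u != 0.
  rewrite mulf_neq0 // -(dvdn_pcharf (pchar_Fp p_prime)) gtnNdvd //.
  by rewrite pn ltnS.
have nz : 1 - psi (- u) != 0.
  rewrite subr_eq0 eq_sym; apply: contraNneq u0 => /(char_eq1 _ _ _ psi0 psiD psi1).
  by move/eqP; rewrite oppr_eq0.
have uu : psi u * psi (- u) = 1 by rewrite -psiD subrr.
move=> h; apply: (mulfI nz); rewrite h.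
have -> : psi (j.+1%:R ^+ 2 + j.+1%:R) = psi (j%:R ^+ 2 + j%:R) * psi u.
  by rewrite -psiD /u -(natr1 j); congr psi; ring.
rewrite [(-1) ^+ j.+1]exprS; ring: uu.
Qed.

(* Gauss: the alternating sum of the q-binomials of row [p - 1] is a product; at a
   [p]-th root of unity its terms become those of the quadratic Gauss sum. *)
Lemma gauss_sum_prod (p n : nat) (p_prime : prime p) (pn : p = n.*2.+1)
    (two0 : (2 : 'F_p) != 0)
    (K : idomainType) (psi : 'F_p -> K) (psi0 : psi 0 = 1)
    (psiD : {morph psi : x y / x + y >-> x * y}) (psi1 : psi 1 != 1) :
  gauss_sum 'F_p K psi 1
  = \prod_(1 <= k < n.+1) (psi k.*2.-1%:R - psi (- k.*2.-1%:R)).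
Proof.
have h2 : 2^-1 = - n%:R :> 'F_p.
  have := pchar_Fp_0 p_prime; rewrite [X in X%:R = 0]pn -natr1 => /eqP.
  rewrite addr_eq0 -mul2n natrM => /eqP h.
  by apply: (mulfI two0); rewrite mulfV // mulrN h opprK.
have S : \sum_(x : 'F_p) psi (x ^+ 2 + x)
    = \prod_(1 <= k < n.+1) (1 - psi (-2) ^+ k.*2.-1).
  rewrite -sum_qbinom sum_Fp // [X in \sum_(0 <= _ < X) _]pn big_mkord; apply: eq_bigr => j _.
  rewrite (qbinom_char p n) //; last by rewrite -ltnS.
  by rewrite mulrA -exprMn mulrNN mulr1 expr1n mul1r.
(* The first [m] odd numbers add up to [m^2]. This spreads the constant [psi (1/4) = psi (n^2)],
   left by completing the square, over the factors of the product and makes each antisymmetric. *)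
have sq m : \prod_(1 <= k < m.+1) psi k.*2.-1%:R = psi (m%:R ^+ 2).
  elim: m => [|m IH]; first by rewrite big_nil expr0n psi0.
  rewrite big_nat_recr //= IH -psiD; congr psi.
  by rewrite -!natr1 -mul2n natrM; ring.
rewrite /gauss_sum (reindex_inj (addrI 2^-1)) /=.
transitivity (psi (2^-1 ^+ 2) * \sum_(x : 'F_p) psi (x ^+ 2 + x)).
  rewrite mulr_sumr; apply: eq_bigr => x _; rewrite -psiD; congr psi.
  by field.
rewrite S h2 sqrrN -sq -big_split /=; apply: eq_bigr => k _.
rewrite mulrBr mulr1 -char_natmul // -psiD; congr (_ - psi _).
by rewrite -(mulr_natr (-2)); ring.
Qed.

(** * The complex exponential and the sign of the Gauss sum *)

Definition cis (R : realType) (x : R) : R[i] := Complex (cos x) (sin x).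

Lemma cis0 (R : realType) : cis R 0 = 1.
Proof. by rewrite /cis cos0 sin0. Qed.

Lemma cisD (R : realType) : {morph cis R : x y / x + y >-> x * y}.
Proof.
move=> x y; apply/eqP; rewrite eq_complex /= cosD sinD.
by apply/andP; split; apply/eqP; ring.
Qed.

Lemma cisB (R : realType) (x : R) : cis R x - cis R (- x) = 'i%C * (2 * sin x)%:C%C.
Proof.
apply/eqP; rewrite eq_complex /= cosN sinN subrr opprK.
by apply/andP; split; apply/eqP; ring.
Qed.

Lemma cis_2pi_nat (R : realType) (k : nat) : cis R (2 * pi * k%:R) = 1.
Proof.
rewrite mulr_natr (char_natmul _ _ _ (cis0 R) (cisD R)).
by rewrite mulr_natl /cis cos2pi sin2pi [Complex 1 0]/(1 : R[i]) expr1n.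
Qed.

(** Real part 1 would give [sin (x / 2) = 0] with [x / 2] strictly between 0 and [pi]. *)
Lemma cis_neq1 (R : realType) (x : R) : 0 < x < 2 * pi -> cis R x != 1.
Proof.
move=> /andP[x0 x2]; apply/negP => /eqP [] + _.
have -> : x = (x / 2) *+ 2 by rewrite -mulr_natr divfK // pnatr_eq0.
rewrite cos_mulr2n cos2sin2 => h.
have : 0 < sin (x / 2) by apply: sin_gt0_pi; apply/andP; split; lra.
move=> /gt_eqF /negP; apply; rewrite -sqrf_eq0; apply/eqP; lra.
Qed.

Definition Fp_char (R : realType) (p : nat) (x : 'F_p) : R[i] :=
  cis R (2 * pi * (x : nat)%:R / p%:R).

Lemma Fp_char_nat (R : realType) (p : nat) (p_prime : prime p) (m : nat) :
  Fp_char R p m%:R = cis R (2 * pi * m%:R / p%:R).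
Proof.
have p0 : p%:R != 0 :> R by rewrite pnatr_eq0 -lt0n prime_gt0.
rewrite /Fp_char val_Fp_nat // [in RHS](divn_eq m p).
have -> : 2 * pi * (m %/ p * p + m %% p)%:R / p%:R
  = 2 * pi * (m %/ p)%:R + 2 * pi * (m %% p)%:R / p%:R :> R.
  by rewrite natrD natrM; field.
by rewrite cisD cis_2pi_nat mul1r.
Qed.

Lemma Fp_char0 (R : realType) (p : nat) : Fp_char R p 0 = 1.
Proof. by rewrite /Fp_char mulr0 mul0r cis0. Qed.

Lemma Fp_charD (R : realType) (p : nat) (p_prime : prime p) :
  {morph Fp_char R p : x y / x + y >-> x * y}.
Proof.
move=> x y; rewrite -(natr_Zp x) -(natr_Zp y) -natrD !Fp_char_nat // -cisD.
by rewrite natrD mulrDr mulrDl.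
Qed.

Lemma Fp_char1 (R : realType) (p : nat) (p_prime : prime p) : Fp_char R p 1 != 1.
Proof.
have -> := Fp_char_nat R p p_prime 1; rewrite mulr1; apply: cis_neq1.
have p0 : 0 < p%:R :> R by rewrite ltr0n prime_gt0.
have pi0 := pi_gt0 R.
by rewrite divr_gt0 ?mulr_gt0 //= ltr_pdivrMr // ltr_pMr ?mulr_gt0 // ltr1n prime_gt1.
Qed.

Lemma Fp_charN (R : realType) (p : nat) (p_prime : prime p) (m : nat) :
  Fp_char R p (- m%:R) = cis R (- (2 * pi * m%:R / p%:R)).
Proof.
have e : Fp_char R p m%:R * Fp_char R p (- m%:R) = 1.
  by rewrite -Fp_charD // subrr Fp_char0.
apply: (mulfI (_ : Fp_char R p m%:R != 0)); rewrite ?e.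
  by apply: contra_eq_neq e => ->; rewrite mul0r eq_sym oner_neq0.
by rewrite Fp_char_nat // -cisD subrr cis0.
Qed.

Lemma Fp_char_int (R : realType) (p : nat) (p_prime : prime p) (m : int) :
  Fp_char R p m%:~R = cis R (2 * pi * m%:~R / p%:R).
Proof.
case: m => m; first exact: Fp_char_nat.
rewrite NegzE !rmorphN /= Fp_charN //.
by rewrite mulrN mulNr.
Qed.

(* The factor [sin (2 pi (2k-1) / p)] is negative exactly when [p < 2(2k-1)], which
   happens for [p %/ 4] of the indices. *)
Lemma prod_sin_sign (R : realType) (p n : nat) (pn : p = n.*2.+1) :
  0 < (-1) ^+ (p %/ 4)
        * \prod_(1 <= k < n.+1) (2 * sin (2 * pi * k.*2.-1%:R / p%:R)) :> R.
Proof.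
have pi0 := pi_gt0 R.
have p0 : 0 < p%:R :> R by rewrite ltr0n; lia.
set m := (p %/ 4)%N; have mn : (m <= n)%N by rewrite /m; lia.
rewrite (big_cat_nat (n := (n - m).+1)) //=; last by lia.
(* One sign goes to each of the last [m] factors, whose angles lie between [pi] and [2 * pi]. *)
have -> : (-1) ^+ m = \prod_((n - m).+1 <= k < n.+1) (-1 : R).
  by rewrite prodr_const_nat; congr (_ ^+ _); lia.
rewrite mulrCA -big_split /=; apply: mulr_gt0; rewrite big_nat;
  apply: prodr_gt0 => k /andP[k1 k2].
  apply: mulr_gt0 => //; apply: sin_gt0_pi; apply/andP; split.
    by rewrite divr_gt0 ?mulr_gt0 // ltr0n; lia.
  rewrite ltr_pdivrMr // mulrAC [ltRHS]mulrC ltr_pM2r // -natrM ltr_nat.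
  by move: k2; rewrite /m; lia.
rewrite mulN1r -mulrN mulr_gt0 // oppr_gt0 -[X in sin X](subrK pi) sinDpi oppr_lt0.
apply: sin_gt0_pi; apply/andP; split.
  rewrite subr_gt0 ltr_pdivlMr // mulrC mulrAC ltr_pM2r // -natrM ltr_nat.
  by move: k1; rewrite /m; lia.
suff: 2 * pi * k.*2.-1%:R / p%:R < 2 * pi :> R by lra.
by rewrite ltr_pdivrMr // ltr_pM2l ?mulr_gt0 // ltr_nat; move: k2; lia.
Qed.

(** The factor [1 - 'i] merges the two cases: the Gauss sum is [sqrt p] for even [n] and
    ['i * sqrt p] for odd [n]. The product formula makes it ['i ^+ n] times a real number, whose
    square is [p] and whose sign is known. *)
Lemma gauss_sum_eval (R : realType) (p n : nat) (p_prime : prime p)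
    (pn : p = n.*2.+1) (n0 : (0 < n)%N) (two0 : (2 : 'F_p) != 0) :
  gauss_sum 'F_p R[i] (Fp_char R p) 1 * (1 - 'i%C)
  = (1 - 'i%C * (-1) ^+ n) * (Num.sqrt p%:R)%:C%C.
Proof.
have psi0 := Fp_char0 R p; have psiD := Fp_charD R p p_prime.
have psi1 := Fp_char1 R p p_prime.
have Fn : #|'F_p| = n.*2.+1 by rewrite card_Fp.
set G := gauss_sum _ _ _ _.
have G2 : (-1) ^+ n * G ^+ 2 = p%:R.
  rewrite -(gauss_sum_conj p p_prime two0 _ _ psi0 psiD psi1).
  rewrite (gauss_sumE p n p_prime pn n0 two0 _ _ psiD psi1 (-1)) ?oppr_eq0 ?oner_eq0 //.
  rewrite (quad_charN1 _ _ Fn) // rmorphXn rmorphN rmorph1 -/G; ring.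
have GE : G = 'i%C ^+ n *
    (\prod_(1 <= k < n.+1) (2 * sin (2 * pi * k.*2.-1%:R / p%:R)))%:C%C.
  rewrite /G (gauss_sum_prod p n) // rmorph_prod /=.
  rewrite -[X in 'i%C ^+ X](subn1 n.+1) -prodr_const_nat -big_split /=.
  by apply: eq_bigr => k _; rewrite Fp_char_nat // Fp_charN // cisB.
move: GE (prod_sin_sign R p n pn); set r := \prod_(_ <= _ < _) _ => GE r0.
have r2 : r ^+ 2 = p%:R.
  apply: (@complexI R); rewrite rmorphXn rmorph_nat -G2 GE exprMn mulrA.
  by rewrite -exprM mulnC exprM sqr_i -exprMn mulrNN mulr1 expr1n mul1r.
have rE : r = (-1) ^+ (p %/ 4) * Num.sqrt p%:R.
  have <- : (-1) ^+ (p %/ 4) * r = Num.sqrt p%:R.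
    by rewrite -r2 sqrtr_sqr -(gtr0_norm r0) normrM normr_sign mul1r.
  by rewrite mulrA -expr2 sqrr_sign mul1r.
rewrite GE rE rmorphM rmorphXn rmorphN rmorph1 /=.
set w := (Num.sqrt _)%:C%C.
(* Here [p] is [4m + 1] or [4m + 3], so [p %/ 4 = m] and its sign cancels the one in ['i ^+ n]. *)
case: (boolP (odd n)) (odd_double_half n) => no /=; set m := n./2 => nE.
  have -> : (p %/ 4 = m)%N by rewrite /m; lia.
  rewrite -signr_odd no -nE exprS -mul2n exprM sqr_i.
  rewrite [LHS](_ : _ = ((-1) ^+ m * (-1) ^+ m) * ('i%C - 'i%C ^+ 2) * w); last by ring.
  by rewrite -expr2 sqrr_sign sqr_i; ring.
have -> : (p %/ 4 = m)%N by rewrite /m; lia.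
rewrite -signr_odd (negPf no) -nE -mul2n exprM sqr_i.
rewrite [LHS](_ : _ = ((-1) ^+ m * (-1) ^+ m) * (1 - 'i%C) * w); last by ring.
by rewrite -expr2 sqrr_sign; ring.
Qed.

(** * The character sum at ['i] and the tangent as a simple fraction *)

Lemma sum_even_reflect (V : nmodType) (f : nat -> V) (n : nat) :
  \sum_(0 <= j < n.*2.+1) f j
  = f 0 + \sum_(1 <= k < n.+1) (f k.*2 + f (n.*2.+1 - k.*2)%N).
Proof.
rewrite big_split /=.
have -> : \sum_(1 <= k < n.+1) f (n.*2.+1 - k.*2)%N = \sum_(1 <= k < n.+1) f k.*2.-1.
  rewrite big_nat_rev /=; apply: eq_big_nat => k /andP[k1 kn]; congr f; lia.
elim: n => [|n IH]; first by rewrite big_nat1 !big_nil !addr0.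
rewrite doubleS big_nat_recr //= big_nat_recr //= IH.
rewrite !(big_nat_recr n.+1) //= -!addrA; congr (_ + _).
by rewrite doubleS /=; congr (_ + _); rewrite [RHS]addrC addrA.
Qed.

(** For [j = 2k] the power of ['i] is [(-1)^(n-k)]. For [j = p - 2k] it is [- 'i (-1)^k], and the
    character supplies [(-1)^n]. Each pair therefore shares the factor [(-1)^n (1 - 'i)]. *)
Lemma sum_quad_char_i (R : realType) (p n : nat) (p_prime : prime p)
    (pn : p = n.*2.+1) (n0 : (0 < n)%N) (two0 : (2 : 'F_p) != 0) :
  \sum_(0 <= j < p) (quad_char 'F_p j%:R)%:~R * 'i%C ^+ (p.-1 - j)
  = (-1) ^+ n * (1 - 'i%C) * (quad_char 'F_p 2)%:~R
    * \sum_(1 <= k < n.+1) (-1) ^+ k * (quad_char 'F_p k%:R)%:~R :> R[i].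
Proof.
have Fn : #|'F_p| = n.*2.+1 by rewrite card_Fp.
rewrite [X in \sum_(0 <= _ < X) _]pn sum_even_reflect.
rewrite [in X in X + _]/quad_char eqxx mul0r add0r mulr_sumr.
apply: eq_big_nat => k /andP[k1 kn].
have -> : (n.*2.+1 - k.*2)%:R = -1 * (2 * k%:R) :> 'F_p.
  rewrite -pn natrB; last by rewrite pn; lia.
  by rewrite pchar_Fp_0 // -mul2n natrM; ring.
have -> : k.*2%:R = 2 * k%:R :> 'F_p by rewrite -mul2n natrM.
rewrite !(quad_charM _ _ Fn) // (quad_charN1 _ _ Fn) // !rmorphM rmorphXn rmorphN rmorph1.
have -> : (p.-1 - k.*2 = 2 * (n - k))%N by lia.
have -> : (p.-1 - (n.*2.+1 - k.*2) = (2 * k.-1).+1)%N by lia.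
rewrite [_ ^+ (2 * k.-1).+1]exprS !exprM !sqr_i.
have -> : (-1) ^+ (n - k) = (-1) ^+ n * (-1) ^+ k :> R[i].
  by rewrite -[in RHS](subnK (_ : k <= n)%N) // exprD -mulrA -expr2 sqrr_sign mulr1.
have -> : (-1) ^+ k.-1 = - (-1) ^+ k :> R[i].
  by rewrite -[in RHS](prednK k1) exprS mulN1r opprK.
ring.
Qed.

Lemma tan_quotientE (R : realType) (x : R) :
  cos x != 0 -> cos x != sin x ->
  (1 / (1 - tan x) - 1)%:C%C = 1 / ('i%C - 1) + 1 / (cis R (x + x) - 'i%C).
Proof.
move=> c0 cs; set c := cos x; set s := sin x.
have d0 : c - s != 0 by rewrite subr_eq0.
have -> : 1 / (1 - tan x) - 1 = s / (c - s).
  rewrite /tan -/c -/s; field.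
  by rewrite d0 c0.
have zE : cis R x = c%:C%C + 'i%C * s%:C%C.
  apply/eqP; rewrite eq_complex /=; apply/andP; split; apply/eqP.
    by rewrite -[LHS]/c; ring.
  by rewrite -[LHS]/s; ring.
have i1 : 'i%C - 1 != 0 :> R[i].
  by rewrite eq_complex /= negb_and subr0 oner_eq0 orbT.
have zN : cis R (- x) = c%:C%C - 'i%C * s%:C%C.
  apply/eqP; rewrite eq_complex /= cosN sinN; apply/andP; split; apply/eqP.
    by rewrite -[LHS]/c; ring.
  by rewrite -[LHS]/(- s); ring.
have zz : cis R x * cis R (- x) = 1 by rewrite -cisD subrr cis0.
have z0 : cis R x != 0.
  by apply: contra_eq_neq zz => ->; rewrite mul0r eq_sym oner_neq0.
(* Writing ['i] as ['i * z * z^-1] with [z = cis x] lets [z] factor out, and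
   [z - 'i z^-1 = (c - s)(1 - 'i)]. *)
have wE : cis R (x + x) - 'i%C = (c - s)%:C%C * (1 - 'i%C) * cis R x.
  have ii := sqr_i R.
  rewrite cisD [X in _ - X = _](_ : _ = 'i%C * (cis R x * cis R (- x))).
    by rewrite zN zE rmorphB /=; ring: ii.
  by rewrite zz mulr1.
have d0' : c%:C%C - s%:C%C != 0 :> R[i].
  by rewrite -rmorphB; apply: contra_neq d0 => /complexI.
rewrite wE rmorphM fmorphV rmorphB /=.
have i1' : 1 - 'i%C != 0 :> R[i] by rewrite -opprB oppr_eq0.
apply: (mulIf (mulf_neq0 (mulf_neq0 d0' i1') z0)).
have ii := sqr_i R.
rewrite [LHS](_ : _ = s%:C%C * (1 - 'i%C) * cis R x); last by field.
rewrite [RHS](_ : _ = 1 - (c%:C%C - s%:C%C) * cis R x); last by field; rewrite d0' i1' i1 z0.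
rewrite -[X in _ = X - _]zz zN zE; ring: ii.
Qed.

(** * Evaluation of the cotangent and tangent sums *)

Theorem theorem1p3 (R : realType) (p : nat) (a : int)
    (p_prime : prime p) (p_gt3 : (3 < p)%N) (p_ndvd_a : ~~ (p %| a)%Z) :
  \sum_(1 <= k < ((p - 1) %/ 2).+1)
     1 / (cot (pi * (a%:~R * k%:R ^+ 2 / p%:R)) - 1)
  = \sum_(1 <= k < ((p - 1) %/ 2).+1)
      1 / (1 - tan (pi * (a%:~R * k%:R ^+ 2 / p%:R))) - (p%:R - 1) / 2 :> R
  /\
  \sum_(1 <= k < ((p - 1) %/ 2).+1)
     1 / (1 - tan (pi * (a%:~R * k%:R ^+ 2 / p%:R))) - (p%:R - 1) / 2
  = p%:R / 4 * ((legendre (-1) p)%:~R - 1)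
    + (legendre (-2 * a) p)%:~R * (Num.sqrt p%:R / 2)
      * \sum_(1 <= k < ((p - 1) %/ 2).+1) (-1) ^+ k * (legendre k%:Z p)%:~R :> R.
Proof.
have /even_prime [p2|podd] := p_prime; first by rewrite p2 in p_gt3.
set n := ((p - 1) %/ 2)%N; have pn : p = n.*2.+1 by rewrite /n; lia.
have n0 : (0 < n)%N by lia.
have chp := pchar_Fp p_prime.
have two0 : (2 : 'F_p) != 0 by rewrite -(dvdn_pcharf chp) gtnNdvd //; lia.
have Fn : #|'F_p| = n.*2.+1 by rewrite card_Fp.
have psi0 := Fp_char0 R p; have psiD := Fp_charD R p p_prime.
have psi1 := Fp_char1 R p p_prime.
set th := fun k : nat => pi * (a%:~R * k%:R ^+ 2 / p%:R) : R.
pose b : 'F_p := a%:~R; have b0 : b != 0 by rewrite -(dvdz_pcharf chp).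
pose w k := Fp_char R p (b * k%:R ^+ 2).
have wE k : cis R (th k + th k) = w k.
  have -> : w k = Fp_char R p (a * k%:Z ^+ 2)%:~R.
    by rewrite /w /b rmorphM rmorphXn.
  rewrite Fp_char_int // rmorphM rmorphXn /=; congr cis; rewrite /th.
  by rewrite -[k%:~R]/(k%:R); ring.
have wX k : w k ^+ p = 1.
  by rewrite -(char_natmul _ _ _ psi0 psiD) -(mulr_natr (b * _)) pchar_Fp_0 // mulr0.
have wneq1 k : (1 <= k < n.+1)%N -> w k != 1.
  move=> /andP[k1 kn]; apply: contraNneq b0 => /(char_eq1 _ _ _ psi0 psiD psi1)/eqP.
  rewrite mulf_eq0 expf_eq0 /= -(dvdn_pcharf chp) gtnNdvd ?orbF //; lia.
have ip : 'i%C ^+ p = 'i%C * (-1) ^+ n :> R[i].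
  by rewrite [X in _ ^+ X]pn exprS -mul2n exprM sqr_i.
(* Thus ['i] is not a [p]-th root of unity, and [w k - 'i] never vanishes. *)
have is1 : 1 - 'i%C * (-1) ^+ n != 0 :> R[i].
  have e : (1 - 'i%C * (-1) ^+ n) * (1 + 'i%C * (-1) ^+ n) = 2 :> R[i].
    by rewrite -subr_sqr exprMn sqrr_sign sqr_i; ring.
  by apply: contra_eq_neq e => ->; rewrite mul0r eq_sym pnatr_eq0.
have wneqi k : w k != 'i%C.
  by apply: contraNneq is1 => wi; rewrite -ip -wi wX subrr.
have wneqN1 k : w k != -1.
  apply: contra_eq_neq (wX k) => ->.
  by rewrite -signr_odd podd expr1 eqNr oner_eq0.
have cos2E x : cos (x + x) = cos x ^+ 2 - sin x ^+ 2 :> R by rewrite cosD !expr2.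
have sin2E x : sin (x + x) = 2 * sin x * cos x :> R by rewrite sinD; ring.
have cs2 x := @cos2Dsin2 R x.
(* The excluded values 1, -1 and ['i] of [w k] correspond to [sin = 0], [cos = 0] and [cos = sin],
   so no quotient in the sums takes the default value of division by zero. *)
have sin0 k : (1 <= k < n.+1)%N -> sin (th k) != 0.
  move=> /wneq1; apply: contra_neq => s0; rewrite -wE /cis cos2E sin2E s0.
  by rewrite expr0n subr0 cos2sin2 s0 expr0n subr0 mulr0 mul0r.
have cos0 k : cos (th k) != 0.
  move: (wneqN1 k); apply: contra_neq => c0; rewrite -wE /cis cos2E sin2E c0.
  rewrite sin2cos2 c0 expr0n subr0 sub0r mulr0.
  by apply/eqP; rewrite eq_complex /= oppr0 !eqxx.
have cs0 k : cos (th k) != sin (th k).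
  move: (wneqi k); apply: contra_neq => e; rewrite -wE /cis cos2E sin2E e subrr.
  by congr Complex; have := cs2 (th k); rewrite e => h; rewrite -[RHS]h; ring.
have T k : (1 <= k < n.+1)%N ->
    1 / (cot (th k) - 1) = 1 / (1 - tan (th k)) - 1.
  move=> hk; rewrite /cot /tan; field.
  by rewrite cos0 sin0 //= subr_eq0 cs0.
have nR : (p%:R - 1) / 2 = n%:R :> R.
  by rewrite [X in X%:R]pn -natr1 -mul2n natrM; field.
have sumT : \sum_(1 <= k < n.+1) 1 / (1 - tan (th k)) - (p%:R - 1) / 2
    = \sum_(1 <= k < n.+1) (1 / (1 - tan (th k)) - 1).
  by rewrite sumrB sumr_const_nat subn1 nR.
split; first by rewrite sumT; apply: eq_big_nat.
pose A := \sum_(1 <= k < n.+1) (-1) ^+ k * (quad_char 'F_p k%:R)%:~R : R.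
have -> : \sum_(1 <= k < n.+1) (-1) ^+ k * (legendre k%:Z p)%:~R = A.
  by apply: eq_bigr => k _; rewrite legendreE.
have AC : A%:C%C = \sum_(1 <= k < n.+1) (-1) ^+ k * (quad_char 'F_p k%:R)%:~R.
  rewrite rmorph_sum; apply: eq_bigr => k _.
  by rewrite rmorphM rmorphXn rmorphN rmorph1 rmorph_int.
rewrite !legendreE // (_ : (-2 * a)%:~R = -1 * (2 * b)); last first.
  by rewrite rmorphM /= mulrA mulN1r.
rewrite (_ : (-1)%:~R = -1 :> 'F_p) // !(quad_charM _ _ Fn) // !(quad_charN1 _ _ Fn) //.
rewrite sumT; apply: (@complexI R).
rewrite rmorph_sum (eq_bigr _ (fun k _ => tan_quotientE _ _ (cos0 k) (cs0 k))) /=.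
under eq_bigr do rewrite wE.
rewrite big_split sumr_const_nat subn1 /=.
set W := \sum_(1 <= k < n.+1) _.
set G := gauss_sum 'F_p R[i] (Fp_char R p) 1.
have G1 := gauss_sum_eval R p n p_prime pn n0 two0; rewrite -/G in G1.
(* Since [k] and [- k] have the same square, doubling gives the Gauss sum without its term 1 at
   zero. The last summand covers [c = 0], where the Gauss sum is [p]. *)
have GE c : 2 * \sum_(1 <= k < n.+1) Fp_char R p (c * k%:R ^+ 2)
    = (quad_char 'F_p c)%:~R * G - 1 + (p * (c == 0%R))%:R.
  have : gauss_sum 'F_p R[i] (Fp_char R p) c
      = (quad_char 'F_p c)%:~R * G + (p * (c == 0%R))%:R.
    case: (eqVneq c 0) => [->|c0]; last first.
      by rewrite muln0 addr0 (gauss_sumE p n).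
    rewrite /quad_char eqxx mul0r add0r muln1 /gauss_sum.
    under eq_bigr do rewrite mul0r psi0.
    by rewrite sumr_const card_Fp.
  rewrite addrAC => <-; rewrite /gauss_sum (sum_Fp_half p n) //.
  rewrite expr0n mulr0 psi0 addrC addKr mulr_sumr.
  by apply: eq_bigr => k _; rewrite sqrrN mulr_natl.
have WE : 2 * (1 - 'i%C * (-1) ^+ n) * W
   = \sum_(0 <= j < p) 'i%C ^+ (p.-1 - j) *
       ((quad_char 'F_p (b * j%:R))%:~R * G - 1 + (p * (j == 0%N))%:R).
  rewrite -mulrA /W.
  (* Geometric sum for [('i ^+ p - w ^+ p) / ('i - w)], with [w ^+ p = 1]. *)
  have E k : (1 - 'i%C * (-1) ^+ n) * (1 / (w k - 'i%C))
      = \sum_(0 <= j < p) 'i%C ^+ (p.-1 - j) * Fp_char R p (b * j%:R * k%:R ^+ 2).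
    transitivity (('i%C ^+ p - w k ^+ p) / ('i%C - w k)).
      by rewrite ip wX -(opprB (w k) 'i%C) -(opprB 1 (_ * _)) invrN mulrNN mul1r.
    rewrite subrXX mulrAC mulfV; last by rewrite subr_eq0 eq_sym.
    rewrite mul1r big_mkord; apply: eq_bigr => j _; congr (_ * _).
    by rewrite -(char_natmul _ _ _ psi0 psiD) -(mulr_natr (b * _)); congr Fp_char; ring.
  rewrite mulr_sumr; under eq_bigr do rewrite E.
  rewrite exchange_big mulr_sumr /=.
  apply: eq_big_nat => j /andP[_ jp]; rewrite -mulr_sumr mulrCA GE.
  rewrite mulf_eq0 (negPf b0) -(dvdn_pcharf chp).
  by congr (_ * (_ + (_ * (nat_of_bool _))%:R)); case: j jp => [|j] jp; rewrite ?dvdn0 // gtnNdvd.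
pose E0 := \sum_(0 <= j < p) 'i%C ^+ (p.-1 - j) : R[i].
have E0E : E0 * (1 - 'i%C) = 1 - 'i%C * (-1) ^+ n.
  have := subrXX 'i%C (1 : R[i]) p; rewrite expr1n ip -/E0.
  under eq_bigr do rewrite expr1n mulr1.
  rewrite -(big_mkord xpredT (fun j => 'i%C ^+ (p.-1 - j))) -/E0 => h.
  by rewrite -[RHS]opprB h mulrC -mulNr opprB.
set s := (-1) ^+ n in ip is1 G1 WE E0E *.
have s2 : s ^+ 2 = 1 by rewrite sqrr_sign.
(* The three parts of the bracket give the character sum at ['i], the geometric sum [E0], and the
   single term [j = 0], where ['i ^+ p.-1 = s]. *)
have {}WE : 2 * (1 - 'i%C * s) * W
    = (quad_char 'F_p b)%:~R * G * (s * (1 - 'i%C) * (quad_char 'F_p 2)%:~R * A%:C%C)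
      - E0 + p%:R * s.
  rewrite WE AC -(sum_quad_char_i R p n) // mulr_sumr -sumrN.
  have -> : p%:R * s = \sum_(0 <= j < p) 'i%C ^+ (p.-1 - j) * (p * (j == 0%N))%:R.
    rewrite big_ltn ?prime_gt0 // big_nat big1 => [|j /andP[]]; last first.
      by case: j => // j _ _; rewrite muln0 mulr0.
    by rewrite addr0 muln1 subn0 [X in _ ^+ X.-1]pn /= -mul2n exprM sqr_i mulrC.
  rewrite -!big_split; apply: eq_bigr => j _ /=.
  by rewrite (quad_charM _ _ Fn) // rmorphM /=; ring.
have i2 : 'i%C ^+ 2 = -1 :> R[i] := sqr_i R.
have two0C : (2 : R[i]) != 0 by rewrite pnatr_eq0.
have L2 : (1 - 'i%C) * (1 + 'i%C) = 2 :> R[i] by rewrite -subr_sqr i2; ring.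
have L0 : 1 - 'i%C != 0 :> R[i].
  by apply: contra_eq_neq L2 => ->; rewrite mul0r eq_sym.
have {}E0E : E0 = (1 - 'i%C * s) * (1 + 'i%C) / 2.
  apply: (mulIf L0); rewrite E0E.
  transitivity ((1 - 'i%C * s) * ((1 - 'i%C) * (1 + 'i%C)) / 2); last by ring.
  by rewrite L2 mulfK.
(* With this, every term of [WE] becomes a multiple of [1 - 'i * s], which can be cancelled. *)
have Us : (1 - 'i%C * s) * (s + 'i%C) = 2 * s.
  by ring: i2 s2.
have {}WE : 2 * W = (quad_char 'F_p b)%:~R * (quad_char 'F_p 2)%:~R * s
      * (Num.sqrt p%:R)%:C%C * A%:C%C - (1 + 'i%C) / 2 + p%:R * (s + 'i%C) / 2.
  apply: (mulfI is1); rewrite mulrA (mulrC _ 2) WE E0E.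
  rewrite [X in X - _](_ : _ = (G * (1 - 'i%C)) * ((quad_char 'F_p b)%:~R *
    (quad_char 'F_p 2)%:~R * s * A%:C%C)); last by ring.
  rewrite G1.
  have -> : p%:R * s = p%:R * ((1 - 'i%C * s) * (s + 'i%C)) / 2.
    by rewrite Us; field.
  by field.
have nC : n%:R = (p%:R - 1) / 2 :> R[i].
  by rewrite [X in X%:R - 1]pn -natr1 -mul2n natrM; field.
have iV : 1 / ('i%C - 1) = - (1 + 'i%C) / 2 :> R[i].
  rewrite -opprB invrN mul1r mulNr; congr (- _).
  by apply: (mulfI L0); rewrite mulfV // mulrA L2 mulfV.
(* The imaginary terms cancel: [-(p-1)(1+'i)/2 - (1+'i)/2 + p(s+'i)/2 = p(s-1)/2], where [s] is the
   symbol of -1. *)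
rewrite -(mulr_natr (1 / _)) iV nC.
apply: (mulfI two0C); rewrite mulrDr WE.
rewrite !(rmorphD, rmorphN, rmorphM, rmorphXn, fmorphV, rmorph1, rmorph_int, rmorph_nat) /= -/s.
by field.
Qed.
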